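(* Let $G$ be an edge-colored complete graph $K_n$ whose edges use at least $n+1$ colors. Then $G$ contains a properly colored $C_4$.
   Context: Graphs are finite and simple. An edge-colored graph is a graph with an arbitrary assignment of a color to each edge (not necessarily proper). A subgraph is properly colored if any two of its adjacent edges (edges sharing a vertex) have distinct colors. $C_4$ is the cycle on 4 vertices, as a (not necessarily induced) subgraph. *)

(* Defs.v *)
From mathcomp Require Import all_boot.

Set Implicit Arguments.
Unset Strict Implicit.
Unset Printing Implicit Defensive.

(* A simple graph on T is given by its set of edges, each edge being a
   two-element subset of T.  An edge-coloring is a function col on {set T};
   only its values on the edges of the graph matter. *)

Definition complete_edges (T : finType) : {set {set T}} :=
  [set e : {set T} | #|e| == 2].

Definition colors_used (T : finType) (C : eqType) (E : {set {set T}})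
    (col : {set T} -> C) : seq C :=
  undup [seq col e | e in E].

Definition properly_colored (T : finType) (C : eqType) (H : {set {set T}})
    (col : {set T} -> C) : Prop :=
  forall e f : {set T}, e \in H -> f \in H -> e != f ->
    e :&: f != set0 -> col e != col f.

Definition is_C4 (T : finType) (H : {set {set T}}) : Prop :=
  exists v1 v2 v3 v4 : T, uniq [:: v1; v2; v3; v4] /\
    H = [set [set v1; v2]; [set v2; v3]; [set v3; v4]; [set v4; v1]].

Definition contains_properly_colored_C4 (T : finType) (C : eqType)
    (E : {set {set T}}) (col : {set T} -> C) : Prop :=
  exists H : {set {set T}},
    [/\ H \subset E, is_C4 H & properly_colored H col].

(* Main.v *)
(** Induct on the number of vertices, calling a color private to v when all
    edges of that color contain v.  If deleting v loses at most one color, use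
    induction; so every vertex may be assumed to have two private colors.
    If va and vb have distinct colors private to v, then a-v-b-w-a is properly
    colored unless aw and bw have the same color.  Hence a has no private color
    outside av and ab, so these two edges carry its private colors, and w is
    joined to v, a and b by a single color.  In particular, no edge leaving the
    triangle vab has a color private to its endpoint in the triangle.  With more
    than three vertices, take w outside the triangle vab and let wx be an edge
    of the analogous triangle at w; then v-a-x-w-v is properly colored. *)

Require Import Defs.
From mathcomp Require Import all_boot.

Set Implicit Arguments.
Unset Strict Implicit.
Unset Printing Implicit Defensive.

Section ProperC4.

Variables (T : finType) (C : eqType) (col : {set T} -> C).

Implicit Types (S : {set T}) (v w x y a b : T).

Definition edges_in S : {set {set T}} := [set e in complete_edges T | e \subset S].

(** Boolean, so that the absence of such a cycle can be assumed by contraposition. Opposite edges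
    are disjoint and hence not compared. *)
Definition proper_4cycle v1 v2 v3 v4 : bool :=
  [&& uniq [:: v1; v2; v3; v4],
      col [set v1; v2] != col [set v2; v3],
      col [set v2; v3] != col [set v3; v4],
      col [set v3; v4] != col [set v4; v1] &
      col [set v4; v1] != col [set v1; v2]].

Lemma edges_inP S e :
  reflect (exists x y, [/\ x \in S, y \in S, x != y & e = [set x; y]])
          (e \in edges_in S).
Proof.
rewrite !inE; apply: (iffP andP) => [[/cards2P[x [y [nxy ->]]]]|].
  by rewrite subUset !sub1set => /andP[xS yS]; exists x, y.
by move=> [x [y [xS yS nxy ->]]]; rewrite cards2 nxy subUset !sub1set xS yS.
Qed.

Lemma set2_disjoint a b x y :
  a != x -> a != y -> b != x -> b != y -> [set a; b] :&: [set x; y] = set0.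
Proof.
move=> ax ay bx yb; apply/eqP; rewrite setI_eq0 disjoints_subset.
by rewrite subUset !sub1set !inE !negb_or ax ay bx yb.
Qed.

Lemma proper_4cycle_contains v1 v2 v3 v4 :
  proper_4cycle v1 v2 v3 v4 ->
  contains_properly_colored_C4 (complete_edges T) col.
Proof.
move=> /and5P[Hu h12 h23 h34 h41].
have := Hu; rewrite /= !inE !negb_or andbT.
move=> /andP[/and3P[n12 n13 n14]] /andP[/andP[n23 n24] n34].
exists [set [set v1; v2]; [set v2; v3]; [set v3; v4]; [set v4; v1]]; split.
- apply/subsetP => e; rewrite !inE.
  by case/orP => [/orP[/orP[]|]|] /eqP ->; rewrite cards2 ?n12 ?n23 ?n34 ?[v4 == _]eq_sym ?n14.
- by exists v1, v2, v3, v4.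
have d13 : [set v1; v2] :&: [set v3; v4] = set0 by exact: set2_disjoint.
have d24 : [set v2; v3] :&: [set v4; v1] = set0.
  by apply: set2_disjoint; rewrite // eq_sym.
move=> e f; rewrite !inE.
case/orP => [/orP[/orP[]|]|] /eqP ->; case/orP => [/orP[/orP[]|]|] /eqP -> //;
  rewrite ?eqxx // 1?setIC ?d13 ?d24 ?eqxx // 1?setIC ?d13 ?d24 ?eqxx // => _ _ //;
  by rewrite eq_sym.
Qed.

Definition private_edge S v a : Prop :=
  [/\ a \in S, a != v &
      forall x y, x \in S -> y \in S -> x != y -> x != v -> y != v ->
        col [set x; y] != col [set v; a]].

(** At least two colors of [S] vanish when [v] is deleted, and an edge of a vanishing color must
    have [v] as an end. *)
Lemma two_private_edges S v :
  (size (colors_used (edges_in (S :\ v)) col)).+1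
    < size (colors_used (edges_in S) col) ->
  exists a b, [/\ private_edge S v a, private_edge S v b &
                  col [set v; a] != col [set v; b]].
Proof.
set l' := colors_used _ _; set l := colors_used (edges_in S) col => hl.
pose p := [seq c <- l | c \notin l'].
have up : uniq p by rewrite filter_uniq // undup_uniq.
have sp : 1 < size p.
  have : size [seq c <- l | c \in l'] <= size l'.
    apply: uniq_leq_size; first by rewrite filter_uniq // undup_uniq.
    by move=> c; rewrite mem_filter => /andP[].
  have := count_predC (mem l') l; rewrite /p !size_filter => hc.
  by rewrite -(ltn_add2l (count (mem l') l)) hc addn1 => h; apply: leq_trans hl; rewrite ltnS.
have priv c : c \in p -> exists2 a, private_edge S v a & col [set v; a] = c.
  rewrite mem_filter => /andP[cl'].
  rewrite mem_undup => /imageP[e /edges_inP[x [y [xS yS nxy ->]]] ec].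
  have out x' y' : x' \in S -> y' \in S -> x' != y' -> x' != v -> y' != v ->
      col [set x'; y'] != c.
    move=> x'S y'S n xv yv; apply: contraNneq cl' => <-.
    rewrite mem_undup; apply: image_f; apply/edges_inP.
    by exists x', y'; rewrite !in_setD1 xv yv.
  have [xv|nxv] := eqVneq x v.
    by subst x c; exists y => //; split => //; rewrite eq_sym.
  have [yv|nyv] := eqVneq y v.
    by subst y c; exists x; [split => // *; rewrite [[set v; x]]setUC; apply: out|rewrite setUC].
  by have := out _ _ xS yS nxy nxv nyv; rewrite ec eqxx.
case: p sp up priv => [|c1 [|c2 p]] //= _ /andP[]; rewrite inE negb_or => /andP[n12 _] _ priv.
have [a pa ea] := priv c1 (mem_head _ _).
have [|b pb eb] := priv c2; first by rewrite !inE eqxx orbT.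
by exists a, b; rewrite ea eb.
Qed.

Section NoProper4Cycle.

Variable S : {set T}.
Hypothesis noC4 : forall v1 v2 v3 v4, ~~ proper_4cycle v1 v2 v3 v4.
Hypothesis two_private : forall v, v \in S ->
  exists a b, [/\ private_edge S v a, private_edge S v b &
                  col [set v; a] != col [set v; b]].

(** In the cycle v-b-w-a, the edges at [v] differ by hypothesis, and [bw], [wa] avoid [v], so they
    differ from the private edges [vb], [va]. Only the pair at [w] can clash. *)
Lemma private_pair_twins v a b w :
  private_edge S v a -> private_edge S v b -> col [set v; a] != col [set v; b] ->
  w \in S -> w \notin [:: v; a; b] -> col [set a; w] = col [set b; w].
Proof.
move=> [aS av pa] [bS bv pb] ab wS; rewrite !inE !negb_or => /and3P[wv wa wb].
have nab : a != b by apply: contraNneq ab => ->.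
apply/eqP; apply: contraTT (noC4 v b w a) => ne; rewrite negbK.
rewrite /proper_4cycle /= !inE !negb_or.
rewrite !(eq_sym v) bv wv av (eq_sym b w) wb (eq_sym b a) nab wa /=.
rewrite [[set a; v]]setUC [[set w; a]]setUC ab andbT; apply/and3P; split.
- by rewrite eq_sym pb // eq_sym.
- by rewrite eq_sym.
- by rewrite pa // eq_sym.
Qed.

Lemma private_triangle v : v \in S ->
  exists a b, [/\ private_edge S v a, private_edge S a v &
    forall w x, w \in S -> w \notin [:: v; a; b] -> x \in [:: v; a; b] ->
      ~ private_edge S x w].
Proof.
move=> vS; have [a [b [pa pb nab]]] := two_private vS.
have [[aS av _] [bS bv _]] := (pa, pb).
have ab : a != b by apply: contraNneq nab => ->.
have twins w : w \in S -> w \notin [:: v; a; b] -> col [set a; w] = col [set b; w].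
  exact: private_pair_twins.
(* The edge [yw] avoids [x], so a color that it shares with [xw] is not private to [x]. *)
have nopriv w x y : w \in S -> w != x -> w != y -> y != x -> y \in S ->
    col [set x; w] = col [set y; w] -> ~ private_edge S x w.
  move=> wS wx wy yx yS e [_ _ /(_ y w yS wS)]; rewrite e eqxx.
  by rewrite eq_sym => /(_ wy yx wx).
have outa p : private_edge S a p -> p \in [:: v; b].
  move=> pp; have [pS pna _] := pp; apply/negPn/negP => H.
  have H' : p \notin [:: v; a; b].
    by move: H; rewrite !inE !negb_or pna.
  move: (H'); rewrite !inE !negb_or => /and3P[_ _ nb].
  by apply: (@nopriv p a b _ _ _ _ _ (twins p pS H') pp) => //; rewrite eq_sym.
have [p [q [pp pq npq]]] := two_private aS.
(* Two differently colored private edges at [a] can only end in [v] and [b], so both [av] and [ab]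
   are private. *)
have [pav pab nvb] : [/\ private_edge S a v, private_edge S a b &
    col [set a; v] != col [set a; b]].
  move: (outa p pp) (outa q pq); rewrite !inE => /orP[]/eqP e1 /orP[]/eqP e2;
    subst p q; rewrite ?eqxx // in npq *; by rewrite eq_sym.
exists a, b; split=> // w x wS wn.
have H' : w \notin [:: a; v; b].
  by move: wn; rewrite !inE !negb_or => /and3P[-> -> ->].
have ea := twins w wS wn.
(* The twin property centered at [a] gives [vw] the color of [bw]; with [ea], all three edges from
   [w] to the triangle share one color. *)
have ev := private_pair_twins pav pab nvb wS H'.
move: wn; rewrite !inE !negb_or => /and3P[wv wa wb].
case/or3P => /eqP ->.
- by apply: (nopriv _ _ b).
- by apply: (nopriv _ _ b) => //; rewrite eq_sym.
- by apply: (nopriv _ _ a).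
Qed.

(** Both [va] and [wx] are private at each end. In v-a-x-w each of [ax] and [wv] misses one end of
    either edge, so all consecutive colors differ. *)
Lemma no_proper_4cycle_card : #|S| <= 3.
Proof.
have [->|[v vS]] := set_0Vmem S; first by rewrite cards0.
have [a [b [pva pav out]]] := private_triangle vS.
rewrite leqNgt; apply/negP => S4.
have [w wS wn] : exists2 w, w \in S & w \notin [:: v; a; b].
  apply/subsetPn; apply: contraL S4 => /subset_leq_card h.
  by rewrite -leqNgt; apply: leq_trans h (card_size _).
have [x [_ [pwx pxw _]]] := private_triangle wS.
have [xS xw hwx] := pwx; have [_ _ hxw] := pxw.
have [aS av hva] := pva; have [_ _ hav] := pav.
have xn : x \notin [:: v; a; b].
  by apply/negP => xin; apply: out xin pxw.
move: wn xn; rewrite !inE !negb_or => /and3P[wv wa _] /and3P[xv xa _].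
have := noC4 v a x w; rewrite /proper_4cycle /= !inE !negb_or.
rewrite !(eq_sym v) (eq_sym a x) (eq_sym a w) av xv wv xa wa xw /=.
apply/negP; rewrite negbK; apply/and4P; split.
- by rewrite eq_sym hva // eq_sym.
- by rewrite [[set x; w]]setUC hwx // eq_sym.
- by rewrite eq_sym hxw // eq_sym.
- by rewrite [[set v; a]]setUC hav // eq_sym.
Qed.

End NoProper4Cycle.

Lemma colors_edges_in_leq S :
  size (colors_used (edges_in S) col) <= 'C(#|S|, 2).
Proof.
apply: leq_trans (size_undup _) _; rewrite size_map -cardE -cards_draws.
by apply: subset_leq_card; apply/subsetP => e; rewrite !inE andbC.
Qed.

(** Ranging over subsets [S] of a fixed vertex type lets the induction delete vertices while keeping
    the same [col]. *)
Lemma proper_4cycle_exists S :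
  #|S| < size (colors_used (edges_in S) col) ->
  [exists v1, exists v2, exists v3, exists v4, proper_4cycle v1 v2 v3 v4].
Proof.
move: {2}#|S| (leqnn #|S|) => m; elim: m S => [|m IHm] S Sm hS.
  have := leq_trans hS (colors_edges_in_leq S).
  by move: Sm; rewrite leqn0 => /eqP ->.
have [/exists_inP[v vS few]|/exists_inPn many] := boolP [exists v in S,
    size (colors_used (edges_in S) col)
      <= (size (colors_used (edges_in (S :\ v)) col)).+1].
  have cS := cardsD1 v S; rewrite vS add1n in cS.
  apply: (IHm (S :\ v)); first by rewrite -ltnS -cS.
  (* One vertex and at most one color are lost, so the strict inequality survives. *)
  by rewrite -ltnS -cS; apply: leq_trans few.
apply: contraT => no.
have noC4 v1 v2 v3 v4 : ~~ proper_4cycle v1 v2 v3 v4.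
  apply: contra no => H; apply/existsP; exists v1; apply/existsP; exists v2.
  by apply/existsP; exists v3; apply/existsP; exists v4.
have S3 : #|S| <= 3.
  apply: no_proper_4cycle_card noC4 _ => v vS.
  by apply: two_private_edges; rewrite ltnNge many.
have := leq_trans hS (colors_edges_in_leq S).
(* For k at most 3, the binomial coefficient 'C(k, 2) is at most k, too few edges for more than k
   colors. *)
by case: #|S| S3 => [|[|[|[|k]]]].
Qed.

End ProperC4.

Theorem theorem4 (n : nat) (C : eqType) (col : {set 'I_n} -> C)
    (hcol : n.+1 <= size (colors_used (complete_edges 'I_n) col)) :
  contains_properly_colored_C4 (complete_edges 'I_n) col.
Proof.
have eT : edges_in [set: 'I_n] = complete_edges 'I_n.
  by apply/setP => e; rewrite in_set subsetT andbT.
have : #|[set: 'I_n]| < size (colors_used (edges_in [set: 'I_n]) col).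
  by rewrite eT cardsT card_ord.
case/proper_4cycle_exists/existsP => v1 /existsP[v2] /existsP[v3] /existsP[v4].
exact: proper_4cycle_contains.
Qed.
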